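(* The quadri-algebra (i.e. the ABQR operad with the four generating operations and nine relations of a quadri-algebra) is isomorphic to the ABQR operad of type $$(\Omega_D,\Lambda_D)\,\square\,(\Omega_D,\Lambda_D)=(\Omega_D\otimes\Omega_D,\ \Lambda_D\,\square\,\Lambda_D),$$ where $(\Omega_D,\Lambda_D)$ is the type of the dendriform dialgebra.
   Context: $\mathbf{k}$ is a field of characteristic zero. A binary, quadratic, regular operad is identified with its type: a pair $(\Omega,\Lambda)$ with $\Omega$ a finite-dimensional $\mathbf{k}$-vector space of binary operations and $\Lambda\subseteq\Omega^{\otimes 2}\oplus\Omega^{\otimes 2}$ a linear subspace; the element $\big(\sum_i a_i\otimes b_i,\ \sum_j c_j\otimes d_j\big)$ stands for the relation $\sum_i(x\,a_i\,y)\,b_i\,z=\sum_j x\,c_j\,(y\,d_j\,z)$. A structure given by finitely many operation symbols and such relations has type $(\Omega,\Lambda)$ with $\Omega$ having the symbols as basis and $\Lambda$ spanned by the relations. The operad is ABQR with associative operation $\star\in\Omega$ if $(\star\otimes\star,\star\otimes\star)\in\Lambda$. An isomorphism $(\Omega,\Lambda)\to(\Omega',\Lambda')$ of ABQR operads with associative operations $\star,\star'$ is a linear bijection $f:\Omega\to\Omega'$ with $f(\star)=\star'$ and $(f^{\otimes2}\oplus f^{\otimes2})(\Lambda)=\Lambda'$. Square product: write $\left[{\odot_1\atop\odot_2}\right]:=\odot_1\otimes\odot_2\in\Omega_1\otimes\Omega_2$. For $f_i=(a_i\otimes b_i,\ c_i\otimes d_i)$, $i=1,2$, put $\left[{f_1\atop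 f_2}\right]=\left(\left[{a_1\atop a_2}\right]\otimes\left[{b_1\atop b_2}\right],\ \left[{c_1\atop c_2}\right]\otimes\left[{d_1\atop d_2}\right]\right)$, extended bilinearly to $f_i\in\Omega_i^{\otimes2}\oplus\Omega_i^{\otimes2}$ (that is, $((u_1,v_1),(u_2,v_2))\mapsto(\sigma(u_1\otimes u_2),\sigma(v_1\otimes v_2))$, $\sigma$ exchanging the second and third tensor factors). $\Lambda_1\,\square\,\Lambda_2$ is the span of all $\left[{f_1\atop f_2}\right]$ with $f_1\in\Lambda_1,f_2\in\Lambda_2$, and $(\Omega_1,\Lambda_1)\,\square\,(\Omega_2,\Lambda_2)=(\Omega_1\otimes\Omega_2,\Lambda_1\,\square\,\Lambda_2)$, with associative operation $\left[{\star_1\atop\star_2}\right]$. Dendriform dialgebra: $\Omega_D$ has basis $\{\prec,\succ\}$, $\star=\prec+\succ$ is the associative operation, and $\Lambda_D$ is spanned by $(\prec\otimes\prec,\prec\otimes\star)$, $(\succ\otimes\prec,\succ\otimes\prec)$, $(\star\otimes\succ,\succ\otimes\succ)$. Quadri-algebra: generating operations $\nearrow,\nwarrow,\searrow,\swarrow$; auxiliary operations $\wedge=\nearrow+\nwarrow$, $\vee=\searrow+\swarrow$, $\prec=\nwarrow+\swarrow$, $\succ=\nearrow+\searrow$, and associative operation $\star=\wedge+\vee=\prec+\succ$; the nine relations are $(x\nwarrow y)\nwarrow z=x\nwarrow(y\star z)$, $(x\nearrow y)\nwarrow z=x\nearrow(y\prec z)$, $(x\wedge y)\nearrow z=x\nearrow(y\succ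 z)$, $(x\swarrow y)\nwarrow z=x\swarrow(y\wedge z)$, $(x\searrow y)\nwarrow z=x\searrow(y\nwarrow z)$, $(x\vee y)\nearrow z=x\searrow(y\nearrow z)$, $(x\prec y)\swarrow z=x\swarrow(y\vee z)$, $(x\succ y)\swarrow z=x\searrow(y\swarrow z)$, $(x\star y)\searrow z=x\searrow(y\searrow z)$. *)

(* Defs.v *)
From HB Require Import structures.
From mathcomp Require Import all_boot all_order all_algebra.
From mathcomp Require Import ring.

Set Implicit Arguments.
Unset Strict Implicit.
Unset Printing Implicit Defensive.

Import GRing.Theory.
Local Open Scope ring_scope.

(* The tensor product U (x) V of two finite-dimensional spaces is modelled by  *)
(* matrices of coordinates in the library's chosen bases vbasis of U and V.    *)
(* The universal property (tlift_tens, tlift_uniq) makes the choice of bases   *)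
(* irrelevant.                                                                 *)
Section Tensor.
Variable k : fieldType.

Definition tensor (U V : vectType k) : Type :=
  'M[k]_(\dim {:U}%VS, \dim {:V}%VS).

HB.instance Definition _ (U V : vectType k) :=
  Vector.copy (tensor U V) 'M[k]_(\dim {:U}%VS, \dim {:V}%VS).

Definition tens (U V : vectType k) (u : U) (v : V) : tensor U V :=
  \matrix_(i, j) (coord (vbasis {:U}) i u * coord (vbasis {:V}) j v).

(* The linear map on U (x) V induced by a bilinear map b : U -> V -> W. *)
Definition tlift (U V W : vectType k) (b : U -> V -> W) (t : tensor U V) : W :=
  \sum_i \sum_j t i j *: b (vbasis {:U})`_i (vbasis {:V})`_j.

Definition bilin (U V W : vectType k) (b : U -> V -> W) : Prop :=
  (forall v, linear (b^~ v)) /\ (forall u, linear (b u)).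

Fact tlift_is_linear (U V W : vectType k) (b : U -> V -> W) : linear (tlift b).
Proof.
move=> a s t; rewrite /tlift scaler_sumr -big_split /=; apply: eq_bigr => i _.
rewrite scaler_sumr -big_split /=; apply: eq_bigr => j _.
by rewrite !mxE scalerDl scalerA.
Qed.
HB.instance Definition _ (U V W : vectType k) (b : U -> V -> W) :=
  GRing.isLinear.Build k (tensor U V) W _ (tlift b) (@tlift_is_linear U V W b).

End Tensor.

Notation "u \ox v" := (tens u v) (at level 40, left associativity) : ring_scope.

Section TensorTheory.
Variable k : fieldType.
Implicit Types U V W : vectType k.

Lemma tens_bilin U V : bilin (@tens k U V).
Proof.
split=> [v a u1 u2|u a v1 v2]; apply/matrixP=> i j; rewrite !mxE linearP /=.
  by rewrite mulrDl mulrA.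
by rewrite mulrDr mulrCA.
Qed.

Lemma linear_fun_sum U W (f : U -> W) : linear f ->
  forall n (c : 'I_n -> k) (u : 'I_n -> U),
  f (\sum_i c i *: u i) = \sum_i c i *: f (u i).
Proof.
move=> fL n c u; pose g := HB.pack_for {linear U -> W} f
  (GRing.isLinear.Build k U W _ f fL).
rewrite -[f]/(g : U -> W) linear_sum; apply: eq_bigr => i _.
by rewrite linearZ.
Qed.

Lemma tlift_tens U V W (b : U -> V -> W) : bilin b ->
  forall u v, tlift b (u \ox v) = b u v.
Proof.
move=> [bl br] u v.
rewrite {2}(coord_vbasis (memvf u)) (linear_fun_sum (bl v)).
apply: eq_bigr => i _.
rewrite {2}(coord_vbasis (memvf v)) (linear_fun_sum (br _)) scaler_sumr.
by apply: eq_bigr => j _; rewrite mxE scalerA.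
Qed.

Lemma tlift_uniq U V W (g : {linear tensor U V -> W}) :
  g =1 tlift (fun u v => g (u \ox v)).
Proof.
move=> t.
have {1}-> : t = \sum_i \sum_j t i j *: ((vbasis {:U})`_i \ox (vbasis {:V})`_j).
  rewrite [LHS]matrix_sum_delta; apply: eq_bigr => i _; apply: eq_bigr => j _.
  congr (_ *: _); apply/matrixP=> i' j'.
  rewrite !mxE !coord_free ?(basis_free (vbasisP _)) // -natrM mulnb.
  by rewrite (eq_sym i') (eq_sym j').
rewrite linear_sum; apply: eq_bigr => i _; rewrite linear_sum.
by apply: eq_bigr => j _; rewrite linearZ.
Qed.

Lemma tlift_linr U V W (X : vectType k) (b : X -> U -> V -> W) t :
  (forall u v, linear (fun x => b x u v)) -> linear (fun x => tlift (b x) t).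
Proof.
move=> bL a x y; rewrite /tlift scaler_sumr -big_split /=.
apply: eq_bigr => i _; rewrite scaler_sumr -big_split /=.
by apply: eq_bigr => j _; rewrite bL scalerDr !scalerA mulrC.
Qed.

End TensorTheory.

(* relspace U is the ambient space of relations; relation a b c d stands for   *)
(* (x a y) b z = x c (y d z).                                                  *)
Definition relspace (k : fieldType) (U : vectType k) : vectType k :=
  (tensor U U * tensor U U)%type.

Definition relation (k : fieldType) (U : vectType k) (a b c d : U) :
  relspace U := (a \ox b, c \ox d).

(* The type (Omega, Lambda) of an associative, binary, quadratic, regular      *)
(* operad, together with its associative operation.                            *)
Record abqr (k : fieldType) := ABQR {
  ops : vectType k;
  rels : {vspace relspace ops};
  star : ops;
  starP : relation star star star star \in rels }.

Section Isomorphism.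
Variable k : fieldType.

Definition tmap (U V : vectType k) (f : U -> V) : tensor U U -> tensor V V :=
  tlift (fun a b => f a \ox f b).

Definition relmap (U V : vectType k) (f : U -> V) (r : relspace U) :
  relspace V := (tmap f r.1, tmap f r.2).

Fact relmap_is_linear (U V : vectType k) (f : U -> V) : linear (relmap f).
Proof. by move=> a r s; rewrite /relmap /tmap !linearP. Qed.
HB.instance Definition _ (U V : vectType k) (f : U -> V) :=
  GRing.isLinear.Build k (relspace U) (relspace V) _ (relmap f)
    (@relmap_is_linear U V f).

Lemma tmap_tens (U V : vectType k) (f : {linear U -> V}) (a b : U) :
  tmap f (a \ox b) = f a \ox f b.
Proof.
have [tl tr] := tens_bilin V V.
by rewrite /tmap tlift_tens //; split=> [v|u] c x y;
   rewrite linearP ?(tl (f v)) ?(tr (f u)).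
Qed.

Definition abqr_iso (P Q : abqr k) : Prop :=
  exists f : {linear ops P -> ops Q},
    [/\ bijective f, f (star P) = star Q
      & (linfun (relmap f) @: rels P)%VS = rels Q].

End Isomorphism.

Section Square.
Variable k : fieldType.

(* [u1 / u2] = sigma (u1 (x) u2), sigma exchanging the two middle factors. *)
Definition tbracket (U1 U2 : vectType k) (u1 : tensor U1 U1)
    (u2 : tensor U2 U2) : tensor (tensor U1 U2) (tensor U1 U2) :=
  tlift (fun a1 b1 => tlift (fun a2 b2 => (a1 \ox a2) \ox (b1 \ox b2)) u2) u1.

Definition bracket (U1 U2 : vectType k) (f1 : relspace U1) (f2 : relspace U2) :
  relspace (tensor U1 U2) := (tbracket f1.1 f2.1, tbracket f1.2 f2.2).

(* By bilinearity (squareP), brackets of basis elements suffice. *)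
Definition square_rels (U1 U2 : vectType k)
    (L1 : {vspace relspace U1}) (L2 : {vspace relspace U2}) :
    {vspace relspace (tensor U1 U2)} :=
  <<[seq bracket f1 f2 | f1 <- vbasis L1, f2 <- vbasis L2]>>%VS.

Let q (U1 U2 : vectType k) (a1 : U1) (a2 : U2) (b1 : U1) (b2 : U2) :=
  (a1 \ox a2) \ox (b1 \ox b2).

Lemma tens4_lin (U1 U2 : vectType k) :
  [/\ forall a2 b1 b2, linear (fun a1 : U1 => q a1 (a2 : U2) b1 b2),
      forall a1 b1 b2, linear (fun a2 : U2 => q (a1 : U1) a2 b1 b2),
      forall a1 a2 b2, linear (fun b1 : U1 => q a1 (a2 : U2) b1 b2)
    & forall a1 a2 b1, linear (fun b2 : U2 => q (a1 : U1) a2 b1 b2)].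
Proof.
have [l r] := tens_bilin U1 U2.
have [L R] := tens_bilin (tensor U1 U2) (tensor U1 U2).
split=> [a2 b1 b2|a1 b1 b2|a1 a2 b2|a1 a2 b1] c x y; rewrite /q.
- by rewrite (l a2) (L (b1 \ox b2)).
- by rewrite (r a1) (L (b1 \ox b2)).
- by rewrite (l b2) (R (a1 \ox a2)).
by rewrite (r b1) (R (a1 \ox a2)).
Qed.

Lemma tbracket_bilin (U1 U2 : vectType k) : bilin (@tbracket U1 U2).
Proof.
split=> [u2|u1]; first exact: tlift_is_linear.
by apply: tlift_linr => a1 b1; apply: tlift_is_linear.
Qed.

Lemma tbracket_tens (U1 U2 : vectType k) (a1 b1 : U1) (a2 b2 : U2) :
  tbracket (a1 \ox b1) (a2 \ox b2) = (a1 \ox a2) \ox (b1 \ox b2).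
Proof.
have [l1 l2 l3 l4] := tens4_lin U1 U2.
rewrite /tbracket tlift_tens; last first.
  split=> [b|a]; apply: tlift_linr => x y; [exact: l1 | exact: l3].
by rewrite tlift_tens //; split=> [b|a]; [exact: l2 | exact: l4].
Qed.

Lemma bracket_bilin (U1 U2 : vectType k) : bilin (@bracket U1 U2).
Proof.
have [l r] := tbracket_bilin U1 U2.
split=> [f2|f1] c x y; rewrite /bracket.
  by rewrite (l f2.1) (l f2.2).
by rewrite (r f1.1) (r f1.2).
Qed.

Lemma bracket_relation (U1 U2 : vectType k) (a1 b1 c1 d1 : U1)
    (a2 b2 c2 d2 : U2) :
  bracket (relation a1 b1 c1 d1) (relation a2 b2 c2 d2) =
  relation (a1 \ox a2) (b1 \ox b2) (c1 \ox c2) (d1 \ox d2).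
Proof. by rewrite /bracket !tbracket_tens. Qed.

Lemma square_mem (U1 U2 : vectType k) (L1 : {vspace relspace U1})
    (L2 : {vspace relspace U2}) f1 f2 :
  f1 \in L1 -> f2 \in L2 -> bracket f1 f2 \in square_rels L1 L2.
Proof.
move=> /coord_vbasis-> /coord_vbasis->; have [l r] := bracket_bilin U1 U2.
rewrite (linear_fun_sum (l _)) rpred_sum // => i _; rewrite rpredZ //.
rewrite (linear_fun_sum (r _)) rpred_sum // => j _; rewrite rpredZ //.
by rewrite memv_span //; apply/allpairsP;
   exists ((vbasis L1)`_i, (vbasis L2)`_j); rewrite /= !mem_nth ?size_tuple.
Qed.

(* square_rels L1 L2 is the smallest subspace containing all brackets. *)
Lemma squareP (U1 U2 : vectType k) (L1 : {vspace relspace U1})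
    (L2 : {vspace relspace U2}) (W : {vspace relspace (tensor U1 U2)}) :
  reflect (forall f1 f2, f1 \in L1 -> f2 \in L2 -> bracket f1 f2 \in W)
          (square_rels L1 L2 <= W)%VS.
Proof.
apply: (iffP idP) => [/subvP sW f1 f2 L1f L2f|LW].
  by apply: sW; apply: square_mem.
apply/span_subvP=> _ /allpairsP[[f1 f2] /= [f1L f2L ->]].
by apply: LW; apply: vbasis_mem.
Qed.

Fact square_starP (P Q : abqr k) :
  relation (star P \ox star Q) (star P \ox star Q)
           (star P \ox star Q) (star P \ox star Q)
  \in square_rels (rels P) (rels Q).
Proof. by rewrite -bracket_relation square_mem ?starP. Qed.

Definition square (P Q : abqr k) : abqr k := ABQR (square_starP P Q).

End Square.

(* The space with basis a finite set I of operation symbols. *)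
Section Free.
Variables (k : fieldType) (I : finType).

Definition free_ops : vectType k := {ffun I -> k^o}.

Definition gen (i : I) : free_ops := [ffun j => (j == i)%:R].

End Free.

Variant dend_op := Dprec | Dsucc.

Definition bool_of_dend o := if o is Dprec then true else false.
Definition dend_of_bool b := if b then Dprec else Dsucc.
Fact bool_of_dendK : cancel bool_of_dend dend_of_bool. Proof. by case. Qed.
HB.instance Definition _ := Finite.copy dend_op (can_type bool_of_dendK).

(* The compass names give the arrows: Qne is the north-east arrow, etc. *)
Variant quadri_op := Qne | Qnw | Qse | Qsw.

Definition bools_of_quadri o :=
  match o with
  | Qne => (true, true) | Qnw => (true, false)
  | Qse => (false, true) | Qsw => (false, false)
  end.
Definition quadri_of_bools b :=
  match b with
  | (true, true) => Qne | (true, false) => Qnw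
  | (false, true) => Qse | (false, false) => Qsw
  end.
Fact bools_of_quadriK : cancel bools_of_quadri quadri_of_bools.
Proof. by case. Qed.
HB.instance Definition _ := Finite.copy quadri_op (can_type bools_of_quadriK).

Section Dendriform.
Variable k : fieldType.

Let prec : free_ops k dend_op := gen k Dprec.
Let succ : free_ops k dend_op := gen k Dsucc.

Definition dend_star : free_ops k dend_op := prec + succ.
Let star := dend_star.

Definition dend_rels : {vspace relspace (free_ops k dend_op)} :=
  <<[:: relation prec prec prec star;
        relation succ prec succ prec;
        relation star succ succ succ]>>%VS.

Fact dend_starP : relation star star star star \in dend_rels.
Proof.
suff -> : relation star star star star =
    relation prec prec prec star + relation succ prec succ prec
    + relation star succ succ succ.
  by rewrite !rpredD // memv_span // !inE eqxx ?orbT.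
by congr pair; apply/matrixP=> i j; rewrite !mxE !linearD /=; ring.
Qed.

Definition dendriform : abqr k := ABQR dend_starP.

End Dendriform.

Section Quadri.
Variable k : fieldType.

Let ne : free_ops k quadri_op := gen k Qne.
Let nw : free_ops k quadri_op := gen k Qnw.
Let se : free_ops k quadri_op := gen k Qse.
Let sw : free_ops k quadri_op := gen k Qsw.

Let wedge := ne + nw.
Let vee := se + sw.
Let prec := nw + sw.
Let succ := ne + se.

Definition quadri_star : free_ops k quadri_op := wedge + vee.
Let star := quadri_star.

Lemma quadri_starE : quadri_star = prec + succ.
Proof. by rewrite /quadri_star /wedge /vee addrACA addrC. Qed.

Definition quadri_rels : {vspace relspace (free_ops k quadri_op)} :=
  <<[:: relation nw nw nw star;    relation ne nw ne prec;
        relation wedge ne ne succ; relation sw nw sw wedge;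
        relation se nw se nw;      relation vee ne se ne;
        relation prec sw sw vee;   relation succ sw se sw;
        relation star se se se]>>%VS.

Fact quadri_starP : relation star star star star \in quadri_rels.
Proof.
suff -> : relation star star star star =
    relation nw nw nw star + relation ne nw ne prec
    + relation wedge ne ne succ + relation sw nw sw wedge
    + relation se nw se nw + relation vee ne se ne
    + relation prec sw sw vee + relation succ sw se sw
    + relation star se se se.
  by rewrite !rpredD // memv_span // !inE eqxx ?orbT.
by congr pair; apply/matrixP=> i j; rewrite !mxE !linearD /=; ring.
Qed.

Definition quadri : abqr k := ABQR quadri_starP.

End Quadri.

(* Main.v *)
(** The isomorphism sends an arrow to the pair of its vertical and horizontal
    components: up becomes [≺] and down [≻] in the first factor, left [≺] and
    right [≻] in the second.  Then [∧] and [∨] become [≺ / ⋆] and [≻ / ⋆], the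
    sums of the quadri-algebra denoted [≺] and [≻] become [⋆ / ≺] and [⋆ / ≻],
    and the nine quadri-algebra relations become the nine brackets of the three
    dendriform relations, which span the square product. *)

Require Import Defs.
From HB Require Import structures.
From mathcomp Require Import all_boot all_order all_algebra.

Set Implicit Arguments.
Unset Strict Implicit.
Unset Printing Implicit Defensive.

Import GRing.Theory.
Local Open Scope ring_scope.

(** By bilinearity of [bracket], any spanning lists may replace the library's chosen bases; the
    square product can thus be computed from the listed dendriform relations. *)
Lemma square_rels_span (k : fieldType) (U1 U2 : vectType k)
    (s1 : seq (relspace U1)) (s2 : seq (relspace U2)) :
  square_rels <<s1>> <<s2>> =
  <<[seq bracket f1 f2 | f1 <- s1, f2 <- s2]>>%VS.
Proof.
apply/eqP; rewrite eqEsubv; apply/andP; split; last first.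
  apply/span_subvP=> _ /allpairsP[[f1 f2] /= [f1s f2s ->]].
  by apply: square_mem; apply: memv_span.
have [l r] := bracket_bilin U1 U2.
apply/squareP=> f1 f2.
rewrite -[s1]in_tupleE -[s2]in_tupleE => /coord_span-> /coord_span->.
rewrite (linear_fun_sum (l _)) rpred_sum // => i _; rewrite rpredZ //.
rewrite (linear_fun_sum (r _)) rpred_sum // => j _; rewrite rpredZ //.
by rewrite memv_span //; apply/allpairsP;
   exists (s1`_i, s2`_j); rewrite /= !mem_nth.
Qed.

Lemma tensDl (k : fieldType) (U V : vectType k) (a b : U) (c : V) :
  (a + b) \ox c = a \ox c + b \ox c.
Proof. by have := (tens_bilin U V).1 c 1 a b; rewrite !scale1r. Qed.

Lemma tensDr (k : fieldType) (U V : vectType k) (a : U) (b c : V) :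
  a \ox (b + c) = a \ox b + a \ox c.
Proof. by have := (tens_bilin U V).2 a 1 b c; rewrite !scale1r. Qed.

Lemma relmap_relation (k : fieldType) (U V : vectType k) (f : {linear U -> V})
    (a b c d : U) :
  relmap f (relation a b c d) = relation (f a) (f b) (f c) (f d).
Proof. by rewrite /relmap /= !tmap_tens. Qed.

Section FreeLift.
Variables (k : fieldType) (I : finType) (V : vectType k) (w : I -> V).

Definition free_lift (x : free_ops k I) : V := \sum_i x i *: w i.

Fact free_lift_is_linear : linear free_lift.
Proof.
move=> a x y; rewrite /free_lift scaler_sumr -big_split /=.
by apply: eq_bigr => i _; rewrite !ffunE scalerDl scalerA.
Qed.
HB.instance Definition _ := GRing.isLinear.Build k (free_ops k I) V _
  free_lift free_lift_is_linear.

Lemma free_lift_gen i : free_lift (gen k i) = w i.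
Proof.
rewrite /free_lift (bigD1 i) //= ffunE eqxx scale1r big1 ?addr0 // => j ji.
by rewrite ffunE (negPf ji) scale0r.
Qed.

End FreeLift.

Lemma gen_sum (k : fieldType) (I : finType) (x : free_ops k I) :
  x = \sum_i x i *: gen k i.
Proof.
apply/ffunP=> j; rewrite sum_ffunE (bigD1 j) //= big1 ?addr0.
  (* Scaling in [k^o] is multiplication in [k], so [mulr1] applies by conversion. *)
  by rewrite !ffunE eqxx; symmetry; apply: mulr1.
by move=> i ij; rewrite !ffunE eq_sym (negPf ij); apply: mulr0.
Qed.

(** Taking linearity as a proof on a bare function lets this apply to [tens] with one argument
    fixed. *)
Lemma linear_free_ops (k : fieldType) (I : finType) (V : vectType k)
    (f : free_ops k I -> V) :
  linear f -> forall x, f x = \sum_i x i *: f (gen k i).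
Proof.
move=> fL x; pose g := HB.pack_for {linear free_ops k I -> V} f
  (GRing.isLinear.Build k (free_ops k I) V _ f fL).
rewrite -[f]/(g : free_ops k I -> V) {1}(gen_sum x) linear_sum.
by apply: eq_bigr => i _; rewrite linearZ.
Qed.

(** Tensors of generators form a basis of the tensor product, and [h] merely relabels this basis by
    [Q]. *)
Lemma tens_free_lift_bij (k : fieldType) (I J Q : finType) (h : Q -> I * J) :
  bijective h ->
  bijective (free_lift (fun q => gen k (h q).1 \ox gen k (h q).2)).
Proof.
move=> hB.
(* The inverse is induced by [b], which reads off the coordinate of [u \ox v] at the pair of
   generators labelled [q]. *)
pose b (u : free_ops k I) (v : free_ops k J) : free_ops k Q :=
  [ffun q => u (h q).1 * v (h q).2].
have bB : bilin b.
  split=> [v|u] a x y; apply/ffunP=> q; rewrite !ffunE.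
    by rewrite mulrDl; congr (_ + _); symmetry; apply: mulrA.
  by rewrite mulrDr; congr (_ + _); apply: mulrCA.
have [l r] := tens_bilin (free_ops k I) (free_ops k J).
set f := free_lift _; exists (tlift b) => [x | t].
  (* On generators: [b] sends the pair labelled [q] to [gen k q], because [h] is injective. *)
  rewrite [RHS]gen_sum /f /free_lift linear_sum; apply: eq_bigr => q _.
  rewrite linearZ /= tlift_tens //; congr (_ *: _); apply/ffunP=> p.
  rewrite !ffunE -natrM mulnb; congr (nat_of_bool _)%:R.
  by rewrite -(inj_eq (bij_inj hB)) -pair_eqE.
(* Expanding [u] and [v] in generators gives a sum over [I * J], which [h] reindexes by [Q]. *)
have fb u v : f (b u v) = u \ox v.
  rewrite (linear_free_ops (l v)).
  under [RHS]eq_bigr => i _ do rewrite (linear_free_ops (r _)) scaler_sumr.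
  rewrite pair_bigA (reindex h) /=; last exact: onW_bij hB.
  by apply: eq_bigr => q _; rewrite !ffunE scalerA.
(* Uniqueness of the lift, applied to the identity, writes [t] as a combination of pure tensors,
   where [fb] applies. *)
rewrite [RHS](tlift_uniq (idfun : {linear tensor _ _ -> _})).
rewrite /tlift /f linear_sum.
apply: eq_bigr => i _; rewrite linear_sum; apply: eq_bigr => j _.
by rewrite linearZ; congr (_ *: _); apply: fb.
Qed.

Definition arrow_components (o : quadri_op) : dend_op * dend_op :=
  match o with
  | Qne => (Dprec, Dsucc) | Qnw => (Dprec, Dprec)
  | Qse => (Dsucc, Dsucc) | Qsw => (Dsucc, Dprec)
  end.

Lemma arrow_components_bij : bijective arrow_components.
Proof.
exists (fun p => match p with
  | (Dprec, Dsucc) => Qne | (Dprec, Dprec) => Qnw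
  | (Dsucc, Dsucc) => Qse | (Dsucc, Dprec) => Qsw end); first by case.
by move=> [[] []].
Qed.

Theorem proposition3p4 (k : fieldType) (char0 : [pchar k]%R =i pred0) :
  abqr_iso (quadri k) (square (dendriform k) (dendriform k)).
Proof.
pose f : {linear free_ops k quadri_op -> tensor _ _} := free_lift (fun o =>
  gen k (arrow_components o).1 \ox gen k (arrow_components o).2).
pose prec := gen k Dprec; pose succ := gen k Dsucc.
have fne : f (gen k Qne) = prec \ox succ := free_lift_gen _ _.
have fnw : f (gen k Qnw) = prec \ox prec := free_lift_gen _ _.
have fse : f (gen k Qse) = succ \ox succ := free_lift_gen _ _.
have fsw : f (gen k Qsw) = succ \ox prec := free_lift_gen _ _.
(* The swap by [addrC] is due to the right arrow coming first here, while [dend_star] begins with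
   [prec]. *)
have fwedge : f (gen k Qne + gen k Qnw) = prec \ox dend_star k.
  by rewrite linearD fne fnw addrC -tensDr.
have fvee : f (gen k Qse + gen k Qsw) = succ \ox dend_star k.
  by rewrite linearD fse fsw addrC -tensDr.
have fprec : f (gen k Qnw + gen k Qsw) = dend_star k \ox prec.
  by rewrite linearD fnw fsw -tensDl.
have fsucc : f (gen k Qne + gen k Qse) = dend_star k \ox succ.
  by rewrite linearD fne fse -tensDl.
have fstar : f (quadri_star k) = dend_star k \ox dend_star k.
  by rewrite linearD fwedge fvee -tensDl.
exists f; split=> //; first exact: tens_free_lift_bij arrow_components_bij.
(* The quadri-algebra relations are listed in the order in which the brackets are enumerated, so the
   two spanning lists agree term by term. *)
rewrite /= /quadri_rels limg_span square_rels_span; congr <<_>>%VS.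
rewrite /= !lfunE /= !relmap_relation !bracket_relation.
by rewrite fne fnw fse fsw fwedge fvee fprec fsucc fstar.
Qed.
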